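(* Let $(X,d)$ be a nonempty compact metric space, let $m\ge1$, let $f_0,\dots,f_{m-1}:X\to X$ be continuous maps and let $G=\{f_0,\dots,f_{m-1}\}$ be the free semigroup action they generate. Suppose $(X,G)$ is chain mixing. Then the topological entropy $h(G)$ satisfies $$h(G)\ \ge\ \max\left\{0,\ \ \underline b\cdot\limsup_{\delta\to0}\frac{\log(1/\delta)}{\lim_{\varepsilon\to0}m_\varepsilon(\delta,G)}-\log m\right\},$$ where $\underline b$ is the lower box dimension of $X$.
   Context: $F_m^+$ is the set of nonempty finite words in the symbols $0,\dots,m-1$; $|w|$ is the length of $w$. For $w=i_0i_1\cdots i_{k-1}$ put $f_w=f_{i_0}\circ f_{i_1}\circ\cdots\circ f_{i_{k-1}}$ and $\overline w=i_{k-1}\cdots i_1i_0$; write $w'\le w$ if $w'$ is a suffix of $w$ (the empty suffix is allowed, with $f_\emptyset=\mathrm{id}$). Topological entropy (Bufetov): for $w\in F_m^+$ let $d_w(x_1,x_2)=\max_{w'\le\overline w}d(f_{w'}(x_1),f_{w'}(x_2))$; $K\subset X$ is $(w,\varepsilon,G)$-separated if $d_w(x_1,x_2)\ge\varepsilon$ for all distinct $x_1,x_2\in K$; $N(w,\varepsilon,G)$ is the maximum cardinality of such a set; $N(n,\varepsilon,G)=\frac1{m^n}\sum_{|w|=n}N(w,\varepsilon,G)$; and $h(G)=\lim_{\varepsilon\to0}\limsup_{n\to\infty}\frac1n\log N(n,\varepsilon,G)$. For $w=i_0\cdots i_{n-1}\in F_m^+$ and $\varepsilon>0$, a $(w,\varepsilon)$-chain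 of $G$ from $x$ to $y$ is a sequence $(x_0=x,x_1,\dots,x_n=y)$ in $X$ with $d(f_{i_j}(x_j),x_{j+1})\le\varepsilon$ for $j=0,\dots,n-1$. $(X,G)$ is chain mixing if for every $\varepsilon>0$ there is $N>0$ such that for all $x,y\in X$ and all $n\ge N$ there is a $(w,\varepsilon)$-chain from $x$ to $y$ for some $w\in F_m^+$ with $|w|=n$. Chain mixing time: for $0<\varepsilon<\delta$ and $x\in X$, $m_\varepsilon(x,\delta,G)$ is the smallest positive integer $N$ such that for every $n\ge N$ and every $y\in X$ there is a $(w,\varepsilon)$-chain from some point of the ball $B(x,\delta)$ to $y$ for some $w\in F_m^+$ with $|w|=n$; $m_\varepsilon(\delta,G)=\max_{x\in X}m_\varepsilon(x,\delta,G)$. It is nondecreasing as $\varepsilon$ decreases, so $\lim_{\varepsilon\to0}m_\varepsilon(\delta,G)$ exists in $[1,\infty]$; a quotient with denominator $\infty$ is $0$, and $0\cdot\infty=0$. Lower box dimension: $\underline b=\liminf_{\rho\to0}\frac{\log N_\rho(X)}{-\log\rho}$, where $N_\rho(X)$ is the smallest number of sets of diameter at most $\rho$ covering $X$. *)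

(* Defs.v *)
From HB Require Import structures.
From mathcomp Require Export all_boot all_order all_algebra finmap.
From mathcomp Require Export all_classical all_reals all_analysis.

Set Implicit Arguments.
Unset Strict Implicit.
Unset Printing Implicit Defensive.

Import Order.TTheory GRing.Theory Num.Theory.
Export numFieldNormedType.Exports.

Local Open Scope classical_set_scope.
Local Open Scope ring_scope.
Local Open Scope ereal_scope.

Section FreeSemigroupAction.
Context {R : realType} {X : metricType R} {m : nat}.
Variable f : 'I_m -> X -> X.

(* f_w = f_(i_0) \o f_(i_1) \o ... \o f_(i_(k-1)) for w = i_0 i_1 ... i_(k-1) *)
Definition word_map (w : seq 'I_m) : X -> X := foldr (fun i g => f i \o g) id w.

(* The suffixes of v are the words drop j v for 0 <= j <= size v, from v itself
   to the empty word (see mem_suffixes below); here v is the reversal of w.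
   Distances are nonnegative, so the neutral element 0 does not affect the
   maximum. *)
Definition suffixes (v : seq 'I_m) : seq (seq 'I_m) :=
  [seq drop j v | j <- iota 0 (size v).+1].

Lemma mem_suffixes (v v' : seq 'I_m) : (v' \in suffixes v) = seq.suffix v' v.
Proof.
apply/mapP/seq.suffixP => [[j _ ->]|[s ->]].
  by exists (take j v); rewrite cat_take_drop.
exists (size s); last by rewrite drop_size_cat.
by rewrite mem_iota /= add0n size_cat ltnS leq_addr.
Qed.

Definition bowen_dist (w : seq 'I_m) (x1 x2 : X) : R :=
  (\big[Num.max/0]_(w' <- suffixes (rev w))
     mdist (word_map w' x1) (word_map w' x2))%R.

Definition separated (w : seq 'I_m) (eps : R) (K : {fset X}) : Prop :=
  forall x1 x2, x1 \in K -> x2 \in K -> x1 <> x2 ->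
    (eps <= bowen_dist w x1 x2)%R.

Definition sep_number (w : seq 'I_m) (eps : R) : \bar R :=
  ereal_sup [set #|` K|%:R%:E | K in separated w eps].

Definition mean_sep_number (n : nat) (eps : R) : \bar R :=
  ((m ^ n)%:R^-1)%:E * \sum_(w : n.-tuple 'I_m) sep_number w eps.

Definition entropy_at (eps : R) : \bar R :=
  limn_esup (fun n => (n%:R^-1)%:E * lne (mean_sep_number n eps)).

Definition topological_entropy : \bar R :=
  lim (entropy_at eps @[eps --> 0%R^'+]).

(* A (w, eps)-chain from x to y; only the values of c on 0, ..., n matter. *)
Definition is_chain (n : nat) (w : n.-tuple 'I_m) (eps : R) (x y : X)
    (c : nat -> X) : Prop :=
  [/\ c 0%N = x, c n = y &
      forall j : 'I_n, (mdist (f (tnth w j) (c j)) (c j.+1) <= eps)%R].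

Definition chain_linked (n : nat) (eps : R) (x y : X) : Prop :=
  exists (w : n.-tuple 'I_m) (c : nat -> X), is_chain w eps x y c.

Definition chain_mixing : Prop :=
  forall eps : R, (0 < eps)%R ->
    exists2 N : nat, (0 < N)%N &
      forall (x y : X) (n : nat), (N <= n)%N -> chain_linked n eps x y.

(* m_eps(x, delta, G), equal to +oo when no admissible N exists. *)
Definition chain_mixing_time_at (eps : R) (x : X) (delta : R) : \bar R :=
  ereal_inf [set N%:R%:E | N in [set N : nat | (0 < N)%N /\
    forall n, (N <= n)%N -> forall y : X,
      exists2 z, ball x delta z & chain_linked n eps z y]].

Definition chain_mixing_time (eps delta : R) : \bar R :=
  ereal_sup [set chain_mixing_time_at eps x delta | x in [set: X]].

Definition limit_chain_mixing_time (delta : R) : \bar R :=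
  lim (chain_mixing_time eps delta @[eps --> 0%R^'+]).

End FreeSemigroupAction.

Section BoxDimension.
Context {R : realType}.

(* With this definition the empty set has diameter -oo; it is still admissible
   as a member of a cover and never shortens one. *)
Definition diam {X : metricType R} (A : set X) : \bar R :=
  ereal_sup [set (mdist p.1 p.2)%:E | p in A `*` A].

Definition covering_number (X : metricType R) (rho : R) : \bar R :=
  ereal_inf [set k%:R%:E | k in [set k : nat | exists A : 'I_k -> set X,
    (forall i, diam (A i) <= rho%:E) /\ \bigcup_i A i = [set: X]]].

Definition lower_box_dim (X : metricType R) : \bar R :=
  limf_einf (fun rho : R => lne (covering_number X rho) / (- ln rho)%:E)
    0%R^'+.

End BoxDimension.

(* Main.v *)
(* Let M be the limit of m_eps(delta) as eps -> 0; only a finite M matters.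
   Letting eps -> 0 in the chains, compactness turns them into exact orbits: for
   one fixed length N <= M, every closed ball of radius delta contains a point
   sent to any prescribed target by some word of length N.  Concatenating such
   pieces backwards, every itinerary of length k through a 3 delta-separated set
   of K points is followed up to delta, at the times 0, N, ..., (k-1) N, by the
   orbit of some point along some word of length k N.  Points following different
   itineraries along the same word are (w, delta)-separated, so the numbers
   N(w, delta, G) with |w| = k N add up to at least K^k, and
   h(G) >= log K / N - log m.  Finally K can be taken to be N_(6 delta)(X), which
   is compared with the lower box dimension. *)
Require Import Defs.
From mathcomp Require Import ring lra.
Set Implicit Arguments.
Unset Strict Implicit.
Unset Printing Implicit Defensive.

Import Order.TTheory GRing.Theory Num.Theory.

Local Open Scope classical_set_scope.
Local Open Scope ring_scope.

(** * Words and the Bowen metric *)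

Lemma word_map_cat (R : realType) (X : metricType R) (m : nat)
    (f : 'I_m -> X -> X) (u v : seq 'I_m) (x : X) :
  word_map f (u ++ v) x = word_map f u (word_map f v x).
Proof. by elim: u => //= i u ->. Qed.

Lemma continuous_word_map (R : realType) (X : metricType R) (m : nat)
    (f : 'I_m -> X -> X) (w : seq 'I_m) :
  (forall i, continuous (f i)) -> continuous (word_map f w).
Proof.
move=> fc; elim: w => [|i w IHw] x /=; first exact: cvg_id.
by apply: (@continuous_comp _ _ _ (word_map f w)); [exact: IHw|exact: fc].
Qed.

(* [word_map f (rev w)] applies the letters of [w] from left to right, as the
   chains do. *)
Lemma mdist_le_bowen_dist (R : realType) (X : metricType R) (m : nat)
    (f : 'I_m -> X -> X) (w : seq 'I_m) (j : nat) (x y : X) :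
  mdist (word_map f (rev (take j w)) x) (word_map f (rev (take j w)) y)
    <= bowen_dist f w x y.
Proof.
rewrite /bowen_dist.
have -> := @le_bigmax_seq _ R _ _ 0 (rev (take j w)) xpredT
  (fun v => mdist (word_map f v x) (word_map f v y)) => //.
by rewrite mem_suffixes -{2}(cat_take_drop j w) rev_cat seq.suffix_suffix.
Qed.

Lemma bowen_dist_gt0_neq (R : realType) (X : metricType R) (m : nat)
    (f : 'I_m -> X -> X) (w : seq 'I_m) (x y : X) :
  0 < bowen_dist f w x y -> x <> y.
Proof.
move=> + xy; rewrite xy ltNge => /negP; apply.
apply: (big_ind (fun t => t <= 0)) => // [s t s0 t0|v _].
  by rewrite ge_max s0 t0.
by rewrite mdistxx.
Qed.

(** * From chains to exact orbits, by compactness *)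

(** The filter form lets one modulus serve all generators at once, since a finite intersection of
    neighbourhoods is a neighbourhood. *)
Lemma compact_unif_continuous (R : realType) (X : metricType R) (g : X -> X)
    (e : R) :
  compact [set: X] -> continuous g -> 0 < e ->
  \forall d \near 0^'+, forall x y, mdist x y < d -> mdist (g x) (g y) < e.
Proof.
move=> /compact_near_coveringP cX gc e0.
suff: \forall d \near 0^'+, [set: X] `<=`
    (fun x => forall y, mdist x y < d -> mdist (g x) (g y) < e).
  by apply: filterS => d gd x; exact: gd.
apply: (cX _ (0 : R)^'+) => x _.
have e20 : 0 < e / 2 by rewrite divr_gt0.
have /nbhs_ballP[r /= r0 xr] := gc x _ (nbhsx_ballx (g x) _ e20).
have r20 : 0 < r / 2 by rewrite divr_gt0.
exists (ball x (r / 2), [set d | d < r / 2]) => /=.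
  split; first exact: nbhsx_ballx.
  exact: nbhs_right_lt.
move=> [x' d] /= [xx' dr] y x'y.
have xx2 : ball x r x'.
  by apply: le_ball xx'; lra.
have xy : ball x r y.
  move: xx'; rewrite !ballEmdist /= => xx'.
  have := metric_triangle x x' y; lra.
move: (xr _ xx2) (xr _ xy) => /=; rewrite !ballEmdist /= => h1 h2.
have := metric_triangle (g x') (g x) (g y); rewrite (metric_sym (g x') (g x)); lra.
Qed.

(** Induction on the length, splitting off the last letter: its map turns the error made so far into
    less than [e / 2], and the last jump adds at most [e / 2]. The tolerance depends on [n] and [e],
    not on the word or the points. *)
Lemma chain_shadowing (R : realType) (X : metricType R) (m : nat)
    (f : 'I_m -> X -> X) (n : nat) (e : R) :
  compact [set: X] -> (forall i, continuous (f i)) -> 0 < e ->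
  exists2 d, 0 < d & forall (w : n.-tuple 'I_m) (x y : X) (c : nat -> X),
    is_chain f w d x y c -> mdist (word_map f (rev w) x) y < e.
Proof.
move=> cX fc; elim: n e => [|n IHn] e e0.
  by exists 1 => // w x y c [<- <- _]; rewrite tuple0 /= mdistxx.
have e20 : 0 < e / 2 by rewrite divr_gt0.
have unif : \forall d \near (0 : R)^'+, forall i x y,
    mdist x y < d -> mdist (f i x) (f i y) < e / 2.
  by apply: filter_forall => i; exact: compact_unif_continuous.
have [d0 [d00 Hd0]] : exists d0 : R, 0 < d0 /\ forall i x y,
    mdist x y < d0 -> mdist (f i x) (f i y) < e / 2.
  near (0 : R)^'+ => d0; exists d0; split; first by [].
  by near: d0.
have [d1 d10 Hd1] := IHn _ d00.
exists (Num.min d1 (e / 2)); first by rewrite lt_min d10.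
move=> w x y c [c0 cn cS].
have [z [w' wE]] : exists z (w' : n.-tuple 'I_m), w = rcons w' z :> seq _.
  case: w {cS} => s /= /eqP ss.
  case/lastP: s ss => // s z; rewrite size_rcons => -[ss].
  by exists z, (tcast ss (in_tuple s)); rewrite val_tcast.
have chain' : is_chain f w' d1 x (c n) c.
  split => // j.
  have := cS (widen_ord (leqnSn n) j).
  rewrite (tnth_nth z) /= wE nth_rcons size_tuple ltn_ord -tnth_nth.
  by rewrite le_min => /andP[].
have lst : mdist (f z (c n)) y <= e / 2.
  have := cS ord_max.
  rewrite (tnth_nth z) /= wE nth_rcons size_tuple ltnn eqxx cn.
  by rewrite le_min => /andP[].
rewrite wE rev_rcons /=.
have := Hd0 z _ _ (Hd1 _ _ _ _ chain').
have := metric_triangle (f z (word_map f (rev w') x)) (f z (c n)) y; lra.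
Unshelve. all: by end_near. Qed.

(** There are finitely many words of length [n], so the images of the closed, hence compact, set
    [closure (ball x d)] have a closed union. Shadowing ever finer chains puts [y] in the closure of
    that union. *)
Lemma exact_reach (R : realType) (X : metricType R) (m : nat)
    (f : 'I_m -> X -> X) (n : nat) (x y : X) (d : R) :
  compact [set: X] -> (forall i, continuous (f i)) ->
  (forall e, 0 < e -> exists2 z, ball x d z & chain_linked f n e z y) ->
  exists (w : n.-tuple 'I_m) (z : X),
    mdist x z <= d /\ word_map f (rev w) z = y.
Proof.
move=> cX fc H.
pose F (w : n.-tuple 'I_m) := word_map f (rev w) @` closure (ball x d).
have clF : closed (\bigcup_(w in [set: n.-tuple 'I_m]) F w).
  apply: closed_bigcup; first exact: finite_finset.
  move=> w _; apply: compact_closed; first exact: metric_hausdorff.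
  apply: continuous_compact.
    by apply: continuous_subspaceT; exact: continuous_word_map.
  exact: (subclosed_compact (@closed_closure _ _) cX).
have [w _ [z /= zB wz]] : (\bigcup_(w in [set: n.-tuple 'I_m]) F w) y.
  apply: clF => A /nbhs_ballP[e /= e0 eA].
  have [e' e'0 shad] := chain_shadowing n cX fc e0.
  have [z xz [w [c wc]]] := H _ e'0.
  exists (word_map f (rev w) z); split.
    by exists w => //; exists z => //; exact: subset_closure.
  by apply: eA; rewrite ballEmdist /= metric_sym; exact: shad wc.
exists w, z; split=> //.
apply/ler_addgt0Pr => e e0.
have [z' [xz' zz']] := zB _ (nbhsx_ballx z _ e0).
move: xz' zz'; rewrite !ballEmdist /= => xz' zz'.
have := metric_triangle x z' z; rewrite (metric_sym z' z); lra.
Qed.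

(** * Separated families, tracking of itineraries and counting *)

(* The closed balls of radius [r] around a separated family with fewer than
   [covering_number X (2 r)] points do not cover, so the family extends. *)
Lemma exists_separated_family (R : realType) (X : metricType R) (r : R)
    (k : nat) :
  (k%:R%:E <= covering_number X (r + r))%E ->
  exists y : 'I_k -> X, forall a b, a != b -> r < mdist (y a) (y b).
Proof.
elim: k => [_|k IHk hk].
  by exists (fun a : 'I_0 => False_rect X (notF (ltn_ord a))) => -[].
have [|y ysep] := IHk.
  by apply: le_trans hk; rewrite lee_fin ler_nat.
have [z zy] : exists z, forall a, r < mdist (y a) z.
  apply/not_existsP => H; move: hk; rewrite leNgt => /negP; apply.
  apply: (@le_lt_trans _ _ k%:R%:E); last by rewrite lte_fin ltr_nat.
  apply: ereal_inf_lbound; exists k => //=.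
  exists (fun a => [set z | mdist (y a) z <= r]); split.
    move=> a; apply: ge_ereal_sup => _ [[p q] /= [ap aq] <-].
    rewrite lee_fin; apply: le_trans (metric_triangle p (y a) q) _.
    by rewrite lerD// metric_sym.
  apply/seteqP; split=> // z _.
  have /existsNP[a /negP] := H z; rewrite -leNgt => az.
  by exists a.
exists (fun a : 'I_k.+1 => if unlift ord_max a is Some b then y b else z).
move=> a b; case: unliftP => [a' ->|->]; case: unliftP => [b' ->|->].
- by rewrite (inj_eq (@lift_inj _ _)); exact: ysep.
- by [].
- by rewrite metric_sym.
- by rewrite eqxx.
Qed.

Section Tracking.
Context {R : realType} {X : metricType R} {m : nat}.
Variables (f : 'I_m -> X -> X) (N K : nat) (d : R) (y : 'I_K -> X).
Hypothesis reach : forall x y : X, exists (w : N.-tuple 'I_m) (z : X),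
    mdist x z <= d /\ word_map f (rev w) z = y.

(** Itineraries are built backwards: the block put in front starts near [y b] and ends exactly at
    the point [z] that tracks the rest, so errors do not accumulate. *)
Lemma exists_tracking (s : seq 'I_K) (x0 : X) :
  exists (w : seq 'I_m) (z : X), size w = (size s * N)%N /\
    forall a j, (j < size s)%N ->
      mdist (y (nth a s j)) (word_map f (rev (take (j * N) w)) z) <= d.
Proof.
elim: s => [|b s [w [z [sw wz]]]]; first by exists [::], x0; split.
have [u [z' [bz' uz']]] := reach (y b) z.
exists (u ++ w), z'; split; first by rewrite size_cat size_tuple sw mulSn.
move=> a [_|j]; first by rewrite mul0n take0.
rewrite ltnS => js; rewrite mulSn take_cat size_tuple ltnNge leq_addr /= addKn.
by rewrite rev_cat word_map_cat uz'; exact: wz.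
Qed.
End Tracking.

(** The indices are grouped by their word; on each group [Z] is injective and its image is a
    separated set for that word. *)
Lemma le_card_sum_sep_number (R : realType) (X : metricType R) (m : nat)
    (f : 'I_m -> X -> X) (I : finType) (n : nat) (e : R)
    (W : I -> n.-tuple 'I_m) (Z : I -> X) :
  0 < e ->
  (forall s t, s != t -> W s = W t -> e <= bowen_dist f (W s) (Z s) (Z t)) ->
  (#|I|%:R%:E <= \sum_(w : n.-tuple 'I_m) sep_number f w e)%E.
Proof.
move=> e0 sepWZ.
have -> : #|I|%:R%:E = (\sum_(w : n.-tuple 'I_m) #|[pred s | W s == w]|%:R%:E)%E
    :> \bar R.
  rewrite sumEFin -natr_sum; congr (_%:R%:E).
  rewrite -sum1_card (partition_big W xpredT)//=.
  by apply: eq_bigr => w _; rewrite -sum1_card; apply: eq_bigl => s; rewrite inE.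
apply: lee_sum => w _; apply: ereal_sup_ubound.
exists [fset Z s | s in [pred s | W s == w]]%fset => /=.
  move=> x y /imfsetP[s /= /eqP sw ->] /imfsetP[t /= /eqP tw ->] st.
  rewrite -{1}sw; apply: sepWZ; last by rewrite sw.
  by apply/eqP => E; apply: st; rewrite E.
congr (_%:R%:E); rewrite card_in_imfset /=; first by rewrite cardE.
move=> s t /= /eqP sw /eqP tw Zst.
apply/eqP; apply: contraT => /sepWZ; rewrite sw tw => /(_ erefl) le.
by have /bowen_dist_gt0_neq := lt_le_trans e0 le; case/(_ Zst).
Qed.

Lemma expn_le_sum_sep_number (R : realType) (X : metricType R) (m : nat)
    (f : 'I_m -> X -> X) (N K k : nat) (d : R) (y : 'I_K -> X) (x0 : X) :
  0 < d ->
  (forall x y : X, exists (w : N.-tuple 'I_m) (z : X),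
    mdist x z <= d /\ word_map f (rev w) z = y) ->
  (forall a b, a != b -> 3 * d < mdist (y a) (y b)) ->
  ((K ^ k)%:R%:E <= \sum_(w : (k * N).-tuple 'I_m) sep_number f w d)%E.
Proof.
move=> d0 reach ysep.
have /choice[g gP] (s : k.-tuple 'I_K) : exists p : (k * N).-tuple 'I_m * X,
    forall j : 'I_k,
    mdist (y (tnth s j)) (word_map f (rev (take (j * N) p.1)) p.2) <= d.
  have [w [z [sw wz]]] := exists_tracking y reach s x0.
  rewrite size_tuple in sw wz; exists (tcast sw (in_tuple w), z) => j /=.
  rewrite (tnth_nth (tnth s j)) val_tcast; exact: wz.
rewrite -{1}(card_ord K) -card_tuple.
apply: (@le_card_sum_sep_number _ _ _ _ _ _ _
  (fun s => (g s).1) (fun s => (g s).2)) => //.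
move=> s t st Wst.
have [j sj] : exists j, tnth s j != tnth t j.
  apply/existsP; apply: contraNT st; rewrite negb_exists => /forallP H.
  by apply/eqP/eq_from_tnth => j; have := H j; rewrite negbK => /eqP.
(* At time [j * N] the orbits are within [d] of two points more than [3 * d] apart, hence more than
   [d] apart themselves. *)
apply: le_trans (mdist_le_bowen_dist _ _ (j * N) _ _).
have := gP t j; rewrite -Wst; have := gP s j; have := ysep _ _ sj.
set p := word_map _ _ (g s).2; set q := word_map _ _ (g t).2 => ypq sp tq.
have := metric_triangle (y (tnth s j)) p (y (tnth t j)).
have := metric_triangle p q (y (tnth t j)).
rewrite (metric_sym q (y _)); lra.
Qed.

(** * Upper limits and monotone one-sided limits *)

Lemma limn_esup_ge (R : realType) (u : nat -> \bar R) (c : \bar R) :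
  (forall n0, exists2 n, (n0 <= n)%N & (c <= u n)%E) -> (c <= limn_esup u)%E.
Proof.
move=> uc; rewrite /limn_esup limf_esupE.
apply: le_ereal_inf_tmp => _ [V [n0 _ Vn0] <-].
have [n n0n cu] := uc n0; apply: le_trans cu _.
by apply: ereal_sup_ubound; exists n => //; exact: Vn0.
Qed.

Lemma limf_esup_le (R : realType) (T : choiceType) (Y : filteredType T)
    (u v : Y -> \bar R) (F : set_system Y) :
  (forall n, (u n <= v n)%E) -> (limf_esup u F <= limf_esup v F)%E.
Proof.
move=> uv; rewrite !limf_esupE; apply: le_ereal_inf_tmp => _ [V FV <-].
apply: (@le_trans _ _ (ereal_sup (u @` V))).
  by apply: ereal_inf_lbound; exists V.
apply: ge_ereal_sup => _ [n Vn <-]; apply: le_trans (uv n) _.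
by apply: ereal_sup_ubound; exists n.
Qed.

(** Monotonicity makes the one-sided limit exist. This serves both the entropy and the mixing time,
    which grow as their scale shrinks. *)
Lemma le_lim_at_right0 (R : realType) (g : R -> \bar R) (e : R) :
  (forall a b, 0 < a -> a <= b -> (g b <= g a)%E) -> 0 < e ->
  (g e <= lim (g x @[x --> 0^'+]))%E.
Proof.
move=> gmon e0; apply: lime_ge.
  apply: nonincreasing_at_right_is_cvge; near=> x => a b.
  by rewrite !in_itv /= => /andP[a0 _] _ ab; exact: gmon.
near=> x; apply: gmon => //.
by near: x; exact: nbhs_right_le.
Unshelve. all: by end_near. Qed.

(** * Lower bounds for the entropy *)

Section Entropy.
Context {R : realType} {X : metricType R} {m : nat}.
Variable f : 'I_m -> X -> X.

Lemma sep_number_ge1 (w : seq 'I_m) (e : R) :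
  [set: X] !=set0 -> (1 <= sep_number f w e)%E.
Proof.
move=> [x0 _]; apply: ereal_sup_ubound; exists [fset x0]%fset => /=.
  by move=> x y /fset1P -> /fset1P ->.
by rewrite cardfs1.
Qed.

Lemma sep_number_ge0 (w : seq 'I_m) (e : R) : (0 <= sep_number f w e)%E.
Proof.
apply: ereal_sup_ubound; exists fset0 => //=.
Qed.

Lemma mean_sep_number_ge0 (n : nat) (e : R) : (0 <= mean_sep_number f n e)%E.
Proof.
by rewrite mule_ge0 ?lee_fin ?invr_ge0// sume_ge0// => w _; exact: sep_number_ge0.
Qed.

Lemma mean_sep_number_ge1 (n : nat) (e : R) :
  (0 < m)%N -> [set: X] !=set0 -> (1 <= mean_sep_number f n e)%E.
Proof.
move=> m0 X0; rewrite /mean_sep_number lee_pdivlMl; last first.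
  by rewrite ltr0n expn_gt0 m0.
rewrite mule1 -{1}(card_ord m) -card_tuple -sum1_card natr_sum -sumEFin.
by apply: lee_sum => w _; exact: sep_number_ge1.
Qed.

Lemma entropy_at_nonincreasing (a b : R) :
  a <= b -> (entropy_at f b <= entropy_at f a)%E.
Proof.
move=> ab; apply: limf_esup_le => n.
rewrite lee_wpmul2l ?lee_fin ?invr_ge0//.
rewrite lee_lne ?in_itv /= ?mean_sep_number_ge0 ?leey//.
rewrite lee_wpmul2l ?lee_fin ?invr_ge0//.
apply: lee_sum => w _; apply: ereal_sup_le => _ [K /= Kb <-]; exists K => //.
by move=> x y xK yK xy; apply: le_trans ab _; exact: Kb.
Qed.

Lemma entropy_at_le (e : R) : 0 < e -> (entropy_at f e <= topological_entropy f)%E.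
Proof.
by move=> e0; apply: le_lim_at_right0 => // a b _; exact: entropy_at_nonincreasing.
Qed.

Lemma topological_entropy_ge0 :
  (0 < m)%N -> [set: X] !=set0 -> (0 <= topological_entropy f)%E.
Proof.
move=> m0 X0; apply: le_trans (entropy_at_le ltr01).
apply: limn_esup_ge => n; exists n => //.
by rewrite mule_ge0 ?lee_fin ?invr_ge0// lne_ge0 mean_sep_number_ge1.
Qed.

Lemma entropy_ge_of_reach (N K : nat) (d : R) (y : 'I_K -> X) :
  [set: X] !=set0 -> (0 < m)%N -> (0 < N)%N -> (0 < K)%N -> 0 < d ->
  (forall x y : X, exists (w : N.-tuple 'I_m) (z : X),
    mdist x z <= d /\ word_map f (rev w) z = y) ->
  (forall a b, a != b -> 3 * d < mdist (y a) (y b)) ->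
  ((ln K%:R / N%:R - ln m%:R)%:E <= topological_entropy f)%E.
Proof.
move=> [x0 _] m0 N0 K0 d0 reach ysep; apply: le_trans (entropy_at_le d0).
(* Only multiples of [N] are controlled, which suffices for an upper limit; [k.+1] keeps the length
   positive. *)
apply: limn_esup_ge => k; exists (k.+1 * N)%N.
  by rewrite (leq_trans (leqnSn k))// leq_pmulr.
set n := (k.+1 * N)%N.
have n0 : (0 < n)%N by rewrite muln_gt0.
have Rn0 : 0 < n%:R :> R by rewrite ltr0n.
have mn0 : 0 < (m ^ n)%:R :> R by rewrite ltr0n expn_gt0 m0.
have Kk0 : 0 < (K ^ k.+1)%:R :> R by rewrite ltr0n expn_gt0 K0.
have H := expn_le_sum_sep_number k.+1 x0 d0 reach ysep.
rewrite lee_pdivlMl// -EFinM.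
(* This half is an equality: [k.+1 * ln K - n * ln m] is [n] times [ln K / N - ln m]. The other half
   is the count [H]. *)
apply: (@le_trans _ _ (lne ((m ^ n)%:R^-1 * (K ^ k.+1)%:R)%:E)).
  rewrite lne_EFin; last by rewrite mulr_gt0// invr_gt0.
  rewrite lnM ?posrE ?invr_gt0// lnV ?posrE// !natrX !lnXn ?ltr0n//.
  rewrite lee_fin -[ln m%:R *+ n]mulr_natl -[ln K%:R *+ _]mulr_natl /n natrM.
  have N0' : N%:R != 0 :> R by rewrite pnatr_eq0 -lt0n.
  by rewrite le_eqVlt; apply/orP; left; apply/eqP; field.
rewrite lee_lne ?in_itv /= ?mean_sep_number_ge0 ?leey ?andbT//.
  by rewrite EFinM lee_wpmul2l ?lee_fin ?invr_ge0.
Qed.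
End Entropy.

(** * Chain mixing times and their limit *)

Section ChainMixingTime.
Context {R : realType} {X : metricType R} {m : nat}.
Variable f : 'I_m -> X -> X.

Lemma chain_linked_le (n : nat) (a b : R) (x y : X) :
  a <= b -> chain_linked f n a x y -> chain_linked f n b x y.
Proof.
move=> ab [w [c [c0 cn cS]]]; exists w, c; split=> // j.
exact: le_trans (cS j) ab.
Qed.

Lemma chain_mixing_time_le (e d : R) :
  0 < e -> (chain_mixing_time f e d <= limit_chain_mixing_time f d)%E.
Proof.
move=> e0; apply: (le_lim_at_right0 (g := fun e => chain_mixing_time f e d)) => //.
move=> a b _ ab; apply: ge_ereal_sup => _ [x _ <-].
apply: (@le_trans _ _ (chain_mixing_time_at f a x d)).
  apply: ereal_inf_le_tmp => _ [N /= [N0 HN] <-]; exists N => //; split=> // n Nn y.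
  have [z xz zy] := HN n Nn y; exists z => //; exact: chain_linked_le zy.
by apply: ereal_sup_ubound; exists x.
Qed.

Lemma limit_chain_mixing_time_ge0 (d : R) :
  [set: X] !=set0 -> (0 <= limit_chain_mixing_time f d)%E.
Proof.
move=> [x0 _]; apply: le_trans (chain_mixing_time_le d ltr01).
apply: (@le_trans _ _ (chain_mixing_time_at f 1 x0 d)).
  by apply: le_ereal_inf_tmp => _ [N _ <-]; rewrite lee_fin.
by apply: ereal_sup_ubound; exists x0.
Qed.

(** Mixing times are integers, so the bound [r] can be lowered to its integer part. This gives a
    single length valid for all [e] and [x], as the passage to exact orbits requires. *)
Lemma limit_chain_mixing_time_reach (d r : R) :
  [set: X] !=set0 -> (limit_chain_mixing_time f d <= r%:E)%E ->
  exists N : nat, [/\ (0 < N)%N, N%:R <= r &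
    forall e x y, 0 < e -> exists2 z, ball x d z & chain_linked f N e z y].
Proof.
move=> [x0 _] dr.
have key e x : 0 < e -> (0 < Num.truncn r)%N /\
    forall y, exists2 z, ball x d z & chain_linked f (Num.truncn r) e z y.
  move=> e0.
  have : (chain_mixing_time_at f e x d < (Num.truncn r).+1%:R%:E)%E.
    apply: (@le_lt_trans _ _ r%:E); last by rewrite lte_fin truncnS_gt.
    apply: le_trans dr; apply: le_trans (chain_mixing_time_le d e0).
    by apply: ereal_sup_ubound; exists x.
  move=> /ereal_inf_lt[_ [N [N0 HN] <-]]; rewrite lte_fin ltr_nat ltnS => Nr.
  by split; [exact: leq_trans Nr|move=> y; exact: HN].
(* [truncn] vanishes on negative reals, so its positivity is needed first to conclude
   [truncn r <= r]. *)
have [r0 _] := key 1 x0 ltr01.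
exists (Num.truncn r); split => //.
  by rewrite truncn_le// (le_trans ler01)// -truncn_gt0.
by move=> e x y e0; have [_] := key e x e0; exact.
Qed.
End ChainMixingTime.

(** * Covering numbers and extended-real inequalities *)

Lemma le_lne_covering_number (R : realType) (X : metricType R) (rho v : R) :
  (v%:E <= lne (covering_number X rho))%E ->
  exists k : nat, [/\ (0 < k)%N, (k%:R%:E <= covering_number X rho)%E &
    v <= ln k%:R].
Proof.
have S0 : (0 <= covering_number X rho)%E.
  by apply: le_ereal_inf_tmp => _ [k _ <-]; rewrite lee_fin.
rewrite -{1}(expRK v) -lne_EFin ?expR_gt0//.
rewrite lee_lne ?in_itv /= ?lee_fin ?expR_ge0 ?S0 ?leey// => vS.
have ex_k : exists k, expR v <= k%:R.
  by exists (Num.truncn (expR v)).+1; rewrite ltW// truncnS_gt.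
(* The least integer [k] above [expR v] is at most the size of any admissible cover, since each such
   size is an integer above [expR v]. *)
case: (ex_minnP ex_k) => k vk kmin; exists k; split.
- by rewrite -(ltr0n R) (lt_le_trans (expR_gt0 v)).
- apply: le_ereal_inf_tmp => _ [j Aj <-]; rewrite lee_fin ler_nat kmin//.
  rewrite -lee_fin; apply: le_trans vS _.
  by apply: ereal_inf_lbound; exists j.
- rewrite -[leLHS]expRK ler_ln// posrE ?expR_gt0//.
  exact: lt_le_trans (expR_gt0 v) vk.
Qed.

Lemma lte_between (R : realType) (q : R) (b : \bar R) :
  (q%:E < b)%E -> exists2 c, q < c & (c%:E < b)%E.
Proof.
case: b => [b| |//]; rewrite ?lte_fin => qb.
  by exists ((q + b) / 2); rewrite ?lte_fin; lra.
by exists (q + 1); [lra|exact: ltry].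
Qed.

Lemma limf_esup_le_near (R : realType) (g : R -> \bar R) (a : \bar R) :
  (\forall x \near 0^'+, (g x <= a)%E) -> (limf_esup g 0^'+ <= a)%E.
Proof.
move=> ga; rewrite limf_esupE.
apply: (@le_trans _ _ (ereal_sup (g @` [set x | (g x <= a)%E]))).
  by apply: ereal_inf_lbound; exists [set x | (g x <= a)%E].
by apply: ge_ereal_sup => _ [x gx <-].
Qed.

Lemma limf_esup_ge0_near (R : realType) (g : R -> \bar R) :
  (\forall x \near 0^'+, (0 <= g x)%E) -> (0 <= limf_esup g 0^'+)%E.
Proof.
move=> g0; rewrite limf_esupE; apply: le_ereal_inf_tmp => _ [V V0 <-].
have [x [gx Vx]] : exists x, (0 <= g x)%E /\ V x.
  by apply: (@filter_ex _ (0 : R)^'+); exact: filterI.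
by apply: le_trans gx _; apply: ereal_sup_ubound; exists x.
Qed.

(** Replaces a possibly infinite [b], here the box dimension, by positive reals below it. An
    infinite [l] would contradict the real bound [a] as soon as [b] is positive. *)
Lemma mule_le_of_lt (R : realType) (b l : \bar R) (a : R) :
  (0 <= l)%E -> 0 <= a ->
  (forall c : R, 0 < c -> (c%:E < b)%E -> (c%:E * l <= a%:E)%E) ->
  (b * l <= a%:E)%E.
Proof.
move=> l0 a0 H; have [b0|b0] := leP b 0%E.
  by apply: (@le_trans _ _ 0%E); [exact: mule_le0_ge0|rewrite lee_fin].
have [c c0 cb] := lte_between b0.
have := H c c0 cb; case: l l0 H => [l| |//]; last first.
  by rewrite gt0_muley ?lte_fin// leye_eq.
rewrite lee_fin => l0 H _; have [->|ln0] := eqVneq l 0; first by rewrite mule0 lee_fin.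
have lp : 0 < l by rewrite lt_neqAle eq_sym ln0.
rewrite -lee_pdivlMr// -EFinM leNgt; apply/negP => /lte_between[c' al c'b].
have c'0 : 0 < c' by apply: le_lt_trans al; rewrite divr_ge0.
have := H c' c'0 c'b; rewrite -EFinM lee_fin leNgt -ltr_pdivrMr//.
by rewrite al.
Qed.

(** * Combining the mixing time with the box dimension *)

Section MainEstimate.
Context {R : realType} {X : metricType R} {m : nat}.
Variable f : 'I_m -> X -> X.
Hypotheses (X_nonempty : [set: X] !=set0) (X_compact : compact [set: X]).
Hypotheses (m_gt0 : (0 < m)%N) (f_continuous : forall i, continuous (f i)).

(** A covering number at scale [6 * d] yields a [3 * d]-separated family, and the common length is
    at most [r], so [v / r] is at most [v] over that length. *)
Lemma entropy_ge_covering (d r v : R) :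
  0 < d -> 0 <= v -> (v%:E <= lne (covering_number X (6 * d)))%E ->
  (limit_chain_mixing_time f d <= r%:E)%E ->
  0 < r /\ ((v / r - ln m%:R)%:E <= topological_entropy f)%E.
Proof.
move=> d0 v0 /le_lne_covering_number[k [k0 kC vk]] dr.
have [N [N0 Nr reach]] :=
  limit_chain_mixing_time_reach X_nonempty dr.
have RN0 : 0 < N%:R :> R by rewrite ltr0n.
have r0 : 0 < r by exact: lt_le_trans RN0 Nr.
have [y ysep] : exists y : 'I_k -> X, forall a b, a != b -> 3 * d < mdist (y a) (y b).
  by apply: exists_separated_family; rewrite (_ : 3 * d + 3 * d = 6 * d)//; lra.
split => //; apply: (le_trans _ (entropy_ge_of_reach X_nonempty m_gt0 N0 k0 d0 _ ysep)).
  rewrite lee_fin lerD2r.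
  apply: (@le_trans _ _ (v / N%:R)).
    by rewrite ler_wpM2l// lef_pV2 ?posrE.
  by rewrite ler_wpM2r// invr_ge0.
by move=> x z; apply: exact_reach => // e e0; exact: reach.
Qed.

(* The margin between [c] and an intermediate [c'] absorbs the factor 6 in
   [covering_number X (6 * d)] once [d] is small. *)
Lemma near_entropy_ge (c : R) :
  0 < c -> (c%:E < lower_box_dim X)%E ->
  \forall d \near 0^'+,
    (c%:E * ((ln d^-1)%:E / limit_chain_mixing_time f d) - (ln m%:R)%:E
      <= topological_entropy f)%E.
Proof.
move=> c0 /lte_between[c' cc' c'b].
move: c'b; rewrite /lower_box_dim limf_einfE => /ereal_sup_gt[_ [V [e /= e0 Ve] <-]] c'V.
have lnm0 : 0 <= ln m%:R :> R by rewrite ln_ge0// ler1n.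
near=> d.
have d0 : 0 < d by [].
have d1 : d < 1 / 6 by near: d; apply: nbhs_right_lt; lra.
have de : d < e / 6 by near: d; apply: nbhs_right_lt; lra.
(* This threshold amounts to [c' * (- ln (6 * d)) >= c * (- ln d)]. *)
have dc : d <= expR (- (c' * ln 6 / (c' - c))).
  by near: d; apply: nbhs_right_le; exact: expR_gt0.
have lnd : ln d <= - (c' * ln 6 / (c' - c)).
  by rewrite -[leRHS]expRK ler_ln// posrE expR_gt0.
have ln6d : ln (6 * d) = ln 6 + ln d :> R by rewrite lnM// posrE.
have ln6d0 : ln (6 * d) < 0 by apply: ln_lt0; lra.
have c'C : (c'%:E < lne (covering_number X (6 * d)) / (- ln (6 * d))%:E)%E.
  apply: (lt_le_trans c'V); apply: ereal_inf_lbound; exists (6 * d) => //.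
  apply: Ve => /=; last by lra.
  by rewrite sub0r normrN gtr0_norm; lra.
have cC : ((c * - ln d)%:E <= lne (covering_number X (6 * d)))%E.
  move: c'C; rewrite inver gt_eqF; last by lra.
  rewrite lte_pdivlMr; last by lra.
  move=> /ltW; apply: le_trans; rewrite -EFinM lee_fin ln6d.
  have : c' * ln 6 <= (c' - c) * (- ln d).
    rewrite [leRHS]mulrC -ler_pdivrMr; last by lra.
    by lra.
  by nra.
rewrite lnV ?posrE//.
have := limit_chain_mixing_time_ge0 f d X_nonempty.
(* For an infinite mixing time the quotient is 0, and the bound is [- ln m], at most 0. *)
case E : (limit_chain_mixing_time f d) => [r| |//] _; last first.
  rewrite invey !mule0 add0e; apply: (le_trans _ (topological_entropy_ge0 f m_gt0 X_nonempty)).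
  by rewrite lee_fin oppr_le0.
have lnd0 : 0 <= c * - ln d.
  by rewrite mulr_ge0 ?oppr_ge0 ?ln_le0 ?ltW//; lra.
have [|r0 Hr] := entropy_ge_covering (r := r) d0 lnd0 cC; first by rewrite E.
by rewrite inver gt_eqF// -!EFinM mulrA -EFinB.
Unshelve. all: by end_near. Qed.

End MainEstimate.

Local Open Scope ereal_scope.

Theorem theorem1p3 (R : realType) (X : metricType R)
    (X_nonempty : [set: X] !=set0) (X_compact : compact [set: X])
    (m : nat) (m_gt0 : (0 < m)%N) (f : 'I_m -> X -> X)
    (f_continuous : forall i : 'I_m, continuous (f i))
    (f_mixing : chain_mixing f) :
  Order.max 0
    (lower_box_dim X *
       limf_esup (fun delta : R =>
         (ln delta^-1)%:E / limit_chain_mixing_time f delta) 0%R^'+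
     - (ln m%:R)%:E)
  <= topological_entropy f.
Proof.
have h0 := topological_entropy_ge0 f m_gt0 X_nonempty.
have lnm0 : (0 <= ln m%:R :> R)%R by rewrite ln_ge0// ler1n.
rewrite ge_max h0 andTb.
(* Once the entropy is known to be real, [ln m] can be moved to its side, and [c] can be divided out
   inside the upper limit. *)
have [->|hfin] := eqVneq (topological_entropy f) +oo; first exact: leey.
have /fineK hE : topological_entropy f \is a fin_num.
  by rewrite ge0_fin_numE// ltey.
have fh0 : (0 <= fine (topological_entropy f))%R by rewrite fine_ge0.
rewrite leeBlDr// -hE -EFinD; apply: mule_le_of_lt.
- apply: limf_esup_ge0_near; near=> d.
  rewrite mule_ge0 ?inve_ge0 ?limit_chain_mixing_time_ge0// lee_fin.
  rewrite ln_ge0// invf_ge1//.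
  by near: d; exact: nbhs_right_le.
- exact: addr_ge0.
move=> c c0 cb; rewrite muleC -lee_pdivlMr//; apply: limf_esup_le_near.
have := near_entropy_ge X_nonempty X_compact m_gt0 f_continuous c0 cb.
apply: filterS => d; rewrite leeBlDr// -{1}hE -EFinD => H.
by rewrite lee_pdivlMr// muleC.
Unshelve. all: by end_near. Qed.
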